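(* Let $V:S^{m-1}\to S^{m-1}$ be a doubly stochastic quadratic operator with coefficients $p_{ij,k}$, $i,j,k\in I=\{1,2,\dots,m\}$. Then the coefficients satisfy the following conditions: (a) $\sum_{i,j=1}^m p_{ij,k}=m$ for all $k\in I$; (b) $\sum_{j=1}^m p_{ij,k}\ge \frac12$ for all $i,k\in I$; (c) $\sum_{i,j\in\alpha}p_{ij,k}\le |\alpha|$ for all $\alpha\subset I$ and all $k\in I$, where $|\alpha|$ is the cardinality of $\alpha$.
   Context: $S^{m-1}=\{x=(x_1,\dots,x_m)\in\mathbb{R}^m: x_i\ge 0\ \forall i,\ \sum_{i=1}^m x_i=1\}$. For $x\in S^{m-1}$, $x_{[1]}\ge x_{[2]}\ge\cdots\ge x_{[m]}$ denotes the nonincreasing rearrangement of the coordinates of $x$. For $x,y\in S^{m-1}$, $x\prec y$ ($x$ is majorized by $y$) means $\sum_{i=1}^k x_{[i]}\le\sum_{i=1}^k y_{[i]}$ for every $k=1,\dots,m-1$. A quadratic stochastic operator (q.s.o.) is a map $V:S^{m-1}\to S^{m-1}$ given by $(Vx)_k=\sum_{i,j=1}^m p_{ij,k}x_ix_j$, $k=1,\dots,m$, where $p_{ij,k}=p_{ji,k}\ge 0$ and $\sum_{k=1}^m p_{ij,k}=1$ for all $i,j$. A q.s.o. $V$ is called a doubly stochastic quadratic operator if $Vx\prec x$ for all $x\in S^{m-1}$. *)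

(* Defs.v *)
From HB Require Import structures.
From mathcomp Require Import all_boot all_order all_algebra.
From mathcomp Require Import reals.

Set Implicit Arguments.
Unset Strict Implicit.
Unset Printing Implicit Defensive.

Import Order.TTheory GRing.Theory Num.Theory.
Local Open Scope ring_scope.

Definition in_simplex (R : realType) (m : nat) (x : 'rV[R]_m) : bool :=
  [forall i, 0 <= x ord0 i] && (\sum_i x ord0 i == 1).

(* S^{m-1}: the index is the number m of coordinates, not the dimension. *)
Definition simplex (R : realType) (m : nat) : Type :=
  {x : 'rV[R]_m | in_simplex x}.

Definition coord (R : realType) (m : nat) (x : simplex R m) (i : 'I_m) : R :=
  sval x ord0 i.

Definition rearrangement (R : realType) (m : nat) (x : simplex R m) : seq R :=
  sort >=%R [seq coord x i | i <- enum 'I_m].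

(* x_[i+1]: positions are counted from 0. *)
Definition decr_coord (R : realType) (m : nat) (x : simplex R m) (i : nat) : R :=
  nth 0 (rearrangement x) i.

Definition majorized (R : realType) (m : nat) (x y : simplex R m) : Prop :=
  forall k : nat, (1 <= k <= m.-1)%N ->
    \sum_(i < k) decr_coord x i <= \sum_(i < k) decr_coord y i.

(* [p i j k] is the coefficient p_{ij,k}. *)
Definition is_qso (R : realType) (m : nat) (p : 'I_m -> 'I_m -> 'I_m -> R)
    (V : simplex R m -> simplex R m) : Prop :=
  [/\ forall i j k, p i j k = p j i k,
      forall i j k, 0 <= p i j k,
      forall i j, \sum_k p i j k = 1
    & forall x k, coord (V x) k = \sum_i \sum_j p i j k * coord x i * coord x j].

Definition is_doubly_stochastic (R : realType) (m : nat)
    (p : 'I_m -> 'I_m -> 'I_m -> R) (V : simplex R m -> simplex R m) : Prop :=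
  is_qso p V /\ forall x, majorized (V x) x.

(* Main.v *)
Require Import Defs.
From HB Require Import structures.
From mathcomp Require Import all_boot all_order all_algebra.
From mathcomp Require Import reals.
From mathcomp Require Import lra.

(** The first majorization inequality says that the largest coordinate of
    [V x] is at most the largest coordinate of [x]
    ([majorized_coord_le]).  Evaluating this at the barycentre of the face
    spanned by a nonempty set [A] of vertices, whose largest coordinate is
    [1 / #|A|], gives
    [(\sum_(i, j in A) p i j k) / #|A| ^ 2 <= 1 / #|A|], which is (c)
    ([doubly_stochastic_block_le]).

    The other two conditions follow from (c) by counting.  For (a), the [m]
    numbers [\sum_(i, j) p i j k] are at most [m], and they add up to [m ^ 2]
    because each [p i j _] is a probability vector; so each equals [m].  For
    (b), (c) applied to the complement of [i] leaves at least [m - (m - 1) = 1]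
    for the cross formed by row [i] and column [i]; by symmetry the cross is at
    most twice the row sum. *)

Set Implicit Arguments.
Unset Strict Implicit.
Unset Printing Implicit Defensive.

(* Restores [coord] on the simplex, hidden by [vector.coord]. *)
Import Defs.
Import Order.TTheory GRing.Theory Num.Theory.
Local Open Scope ring_scope.

Lemma coord_sum1 (R : realType) (m : nat) (x : simplex R m) :
  \sum_i coord x i = 1.
Proof. by have /andP[_ /eqP] := svalP x. Qed.

Lemma coord_le_decr_coord0 (R : realType) (m : nat) (x : simplex R m)
    (i : 'I_m) : coord x i <= decr_coord x 0.
Proof.
have : coord x i \in rearrangement x by rewrite mem_sort map_f ?mem_enum.
have : sorted >=%R (rearrangement x).
  by apply: sort_sorted => a b; exact: le_total.
rewrite /decr_coord; case: (rearrangement x) => [//|h t] /= h_t.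
have /allP le_h : all (fun y => y <= h) t.
  by apply: order_path_min h_t => a b c /= ab ca; exact: le_trans ca ab.
by rewrite inE => /orP[/eqP -> //|/le_h].
Qed.

Lemma decr_coord0_le (R : realType) (m : nat) (x : simplex R m) (c : R) :
  (0 < m)%N -> (forall i, coord x i <= c) -> decr_coord x 0 <= c.
Proof.
move=> m_gt0 xc.
have : decr_coord x 0 \in rearrangement x.
  by rewrite mem_nth // size_sort size_map size_enum_ord.
by rewrite mem_sort => /mapP[i _ ->].
Qed.

(** The first majorization inequality is only available when [1 < m]; when
    [m = 1] the simplex is a single point and the bound holds trivially. *)
Lemma majorized_coord_le (R : realType) (m : nat) (x y : simplex R m) (c : R)
    (k : 'I_m) :
  majorized y x -> (forall i, coord x i <= c) -> coord y k <= c.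
Proof.
case: m x y k => [|[|m]] x y k yx xc; first by case: k.
  have coord1 (z : simplex R 1) : coord z k = 1.
    by rewrite -(coord_sum1 z) big_ord1 (ord1 k).
  by rewrite coord1 -(coord1 x).
apply: le_trans (coord_le_decr_coord0 y k) _.
by have := yx 1%N isT; rewrite !big_ord1 => /le_trans; apply; exact: decr_coord0_le.
Qed.

Lemma barycentre_in_simplex (R : realType) (m : nat) (A : {set 'I_m}) :
  A != set0 ->
  in_simplex (\row_i (if i \in A then #|A|%:R^-1 else 0) : 'rV[R]_m).
Proof.
rewrite -card_gt0 => A_gt0; apply/andP; split.
  by apply/forallP => i; rewrite mxE; case: ifP => // _; rewrite invr_ge0 ler0n.
under eq_bigr do rewrite mxE.
rewrite -big_mkcond sumr_const -[X in X == _]mulr_natr mulVf //.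
by rewrite pnatr_eq0 -lt0n.
Qed.

Definition barycentre (R : realType) (m : nat) (A : {set 'I_m})
    (A_neq0 : A != set0) : simplex R m :=
  exist (fun x => in_simplex x) _ (barycentre_in_simplex R A_neq0).

Lemma coord_barycentre (R : realType) (m : nat) (A : {set 'I_m})
    (A_neq0 : A != set0) (i : 'I_m) :
  coord (barycentre R A_neq0) i = if i \in A then #|A|%:R^-1 else 0.
Proof. by rewrite /coord mxE. Qed.

Lemma qso_barycentre (R : realType) (m : nat) (p : 'I_m -> 'I_m -> 'I_m -> R)
    (V : simplex R m -> simplex R m) (A : {set 'I_m}) (A_neq0 : A != set0)
    (k : 'I_m) :
  is_qso p V ->
  coord (V (barycentre R A_neq0)) k =
    (\sum_(i in A) \sum_(j in A) p i j k) * #|A|%:R^-1 * #|A|%:R^-1.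
Proof.
case=> _ _ _ ->; rewrite -mulrA mulr_suml [RHS]big_mkcond; apply: eq_bigr => i _.
rewrite coord_barycentre; case: (i \in A); last first.
  by rewrite big1 // => j _; rewrite mulr0 mul0r.
rewrite mulr_suml [RHS]big_mkcond; apply: eq_bigr => j _.
by rewrite coord_barycentre; case: (j \in A); rewrite ?mulr0 // mulrA.
Qed.

(** The sum over the block is [#|A| ^ 2] times a coordinate of the image of the
    barycentre, and that coordinate is at most [1 / #|A|]. *)
Lemma doubly_stochastic_block_le (R : realType) (m : nat)
    (p : 'I_m -> 'I_m -> 'I_m -> R) (V : simplex R m -> simplex R m)
    (A : {set 'I_m}) (k : 'I_m) :
  is_doubly_stochastic p V ->
  \sum_(i in A) \sum_(j in A) p i j k <= #|A|%:R.
Proof.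
case=> qV dV; have [->|A_neq0] := eqVneq A set0; first by rewrite big_set0.
have A_gt0 : 0 < #|A|%:R :> R by rewrite ltr0n card_gt0.
have := majorized_coord_le (c := #|A|%:R^-1) k (dV (barycentre R A_neq0)).
rewrite (qso_barycentre A_neq0 k qV) => le_inv.
rewrite -[leRHS]mul1r -ler_pdivrMr // -(ler_pM2r (x := #|A|%:R^-1)) ?invr_gt0 //.
rewrite mul1r; apply: le_inv => i.
by rewrite coord_barycentre; case: ifP => // _; rewrite invr_ge0 ltW.
Qed.

Lemma qso_total_sum (R : realType) (m : nat) (p : 'I_m -> 'I_m -> 'I_m -> R)
    (V : simplex R m -> simplex R m) :
  is_qso p V -> \sum_k \sum_i \sum_j p i j k = \sum_(k < m) m%:R.
Proof.
case=> _ _ p_sum1 _; rewrite exchange_big; apply: eq_bigr => i _.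
rewrite exchange_big -[m in RHS]card_ord -sumr_const.
by apply: eq_bigr => j _; exact: p_sum1.
Qed.

(** Every slice is at most [m] by the block bound for the full index set, and
    the average slice is exactly [m]. *)
Lemma doubly_stochastic_slice_sum (R : realType) (m : nat)
    (p : 'I_m -> 'I_m -> 'I_m -> R) (V : simplex R m -> simplex R m)
    (k : 'I_m) :
  is_doubly_stochastic p V -> \sum_i \sum_j p i j k = m%:R.
Proof.
move=> dV.
have sumT (f : 'I_m -> R) : \sum_(i in [set: 'I_m]) f i = \sum_i f i.
  by apply: eq_bigl => i; rewrite inE.
have slice_le l : \sum_i \sum_j p i j l <= m%:R.
  have := doubly_stochastic_block_le [set: 'I_m] l dV.
  rewrite cardsT card_ord sumT.
  by under eq_bigr do rewrite sumT.
(* Terms bounded by m whose sum attains the sum of the bounds are all m. *)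
have /eqP := qso_total_sum dV.1; rewrite eq_sym -subr_eq0 -sumrB psumr_eq0.
  by move=> /allP/(_ k (mem_index_enum k)) /=; rewrite subr_eq0 => /eqP.
by move=> l _; rewrite subr_ge0.
Qed.

(** Isolates the block avoiding [i], the part of the total to which (c)
    applies in the proof of (b). *)
Lemma sum_split_cross (R : realType) (m : nat) (f : 'I_m -> 'I_m -> R)
    (i : 'I_m) :
  \sum_a \sum_b f a b =
    \sum_b f i b + \sum_(a in [set~ i]) f a i +
    \sum_(a in [set~ i]) \sum_(b in [set~ i]) f a b.
Proof.
have compl1 a : (a \in [set~ i]) = (a != i) by rewrite !inE.
rewrite (bigD1 i) //= -addrA -big_split /=; congr (_ + _).
rewrite [RHS](eq_bigl _ _ compl1); apply: eq_bigr => a _.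
by rewrite (bigD1 i) //= [in RHS](eq_bigl _ _ compl1).
Qed.

(** Outside the block avoiding [i], whose sum is at most [m - 1], a sum of at
    least [1] remains, shared between row [i] and the rest of column [i]; the
    latter is at most the row sum because [p] is symmetric and nonnegative. *)
Lemma doubly_stochastic_row_ge (R : realType) (m : nat)
    (p : 'I_m -> 'I_m -> 'I_m -> R) (V : simplex R m -> simplex R m)
    (i k : 'I_m) :
  is_doubly_stochastic p V -> 1 / 2 <= \sum_j p i j k.
Proof.
move=> dV; have [p_sym p_ge0 _ _] := dV.1.
have total := doubly_stochastic_slice_sum k dV.
have block := doubly_stochastic_block_le [set~ i] k dV.
have m_eq : m%:R = 1 + #|[set~ i]|%:R :> R.
  by rewrite cardsC1 card_ord nat1r prednK // (leq_ltn_trans _ (ltn_ord i)).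
have col_le : \sum_(a in [set~ i]) p a i k <= \sum_j p i j k.
  rewrite [leRHS](bigID (mem [set~ i])) /=.
  under [X in X <= _]eq_bigr do rewrite p_sym.
  by rewrite lerDl sumr_ge0.
rewrite (sum_split_cross (fun a b => p a b k) i) in total.
lra.
Qed.

Theorem theorem2p1 (R : realType) (m : nat)
    (p : 'I_m -> 'I_m -> 'I_m -> R) (V : simplex R m -> simplex R m)
    (hV : is_doubly_stochastic p V) :
  [/\ forall k : 'I_m, \sum_i \sum_j p i j k = m%:R,
      forall i k : 'I_m, 1 / 2 <= \sum_j p i j k
    & forall (alpha : {set 'I_m}) (k : 'I_m),
        \sum_(i in alpha) \sum_(j in alpha) p i j k <= #|alpha|%:R].
Proof.
split=> [k|i k|alpha k].
- exact: doubly_stochastic_slice_sum hV.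
- exact: doubly_stochastic_row_ge hV.
- exact: doubly_stochastic_block_le hV.
Qed.
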